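(* Let $(r_k(q))_{k\ge 1}$, $(s_k(q))_{k\ge 0}$, $(t_k(q))_{k\ge 1}$ be three sequences of real polynomials in $q$ with nonnegative coefficients, and let $A(q)=[a_{n,k}(q)]_{n,k\ge 0}$ be the infinite lower triangular matrix with $a_{n,k}(q)=0$ unless $n\ge k\ge 0$, defined for $n,k\ge 0$ by $$a_{0,0}(q)=1,\quad a_{n+1,k}(q)=r_{k}(q)a_{n,k-1}(q)+s_k(q)a_{n,k}(q)+t_{k+1}(q)a_{n,k+1}(q),$$ where for $k=0$ the term $r_k(q)a_{n,k-1}(q)$ is $0$. Then $A(q)$ is $q$-TP if one of the following conditions holds: (i) $s_0(q)\ge_q r_1(q)$ and $s_k(q)\ge_q r_{k+1}(q)+t_{k}(q)$ for all $k\ge 1$. (ii) $s_0(q)\ge_q t_1(q)$ and $s_k(q)\ge_q r_k(q)+t_{k+1}(q)$ for all $k\ge 1$. (iii) $s_0(q)\ge_q 1$ and $s_k(q)\ge_q r_k(q)t_k(q)+1$ for all $k\ge 1$.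
   Context: For real polynomials $f(q),g(q)$ in $q$, write $f(q)\ge_q g(q)$ if all coefficients of the difference $f(q)-g(q)$ are nonnegative. An infinite matrix whose entries are real polynomials in $q$ is called $q$-TP if its minors of all orders have nonnegative coefficients as polynomials in $q$. *)

(* Defs.v *)
From HB Require Import structures.
From mathcomp Require Import all_boot all_order all_algebra.
From mathcomp Require Import reals.

Set Implicit Arguments.
Unset Strict Implicit.
Unset Printing Implicit Defensive.

Import Order.TTheory GRing.Theory Num.Theory.
Local Open Scope ring_scope.

Definition coef_nonneg (R : realType) (p : {poly R}) : Prop :=
  forall i : nat, 0 <= p`_i.

Definition geq_q (R : realType) (f g : {poly R}) : Prop :=
  coef_nonneg (f - g).

(* Infinite matrices are functions nat -> nat -> {poly R}; a minor of order m
   is selected by strictly increasing sequences of m row and column indices. *)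
Definition q_TP (R : realType) (A : nat -> nat -> {poly R}) : Prop :=
  forall (m : nat) (rows cols : 'I_m -> nat),
    {homo rows : i j / (i < j)%N} ->
    {homo cols : i j / (i < j)%N} ->
    coef_nonneg (\det (\matrix_(i < m, j < m) A (rows i) (cols j))).

(* The values r 0 and t 0 are never used. *)
Definition recursive_matrix (R : realType) (r s t : nat -> {poly R})
    (A : nat -> nat -> {poly R}) : Prop :=
  [/\ forall n k : nat, (n < k)%N -> A n k = 0,
      A 0%N 0%N = 1
    & forall n k : nat,
        A n.+1 k = (if k is k'.+1 then r k * A n k' else 0)
                   + s k * A n k + t k.+1 * A n k.+1].

(* Main.v *)
Require Import Defs.
From HB Require Import structures.
From mathcomp Require Import all_boot all_order all_algebra.
From mathcomp Require Import reals.
From mathcomp Require Import all_fingroup zify ring.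

(** Let [J] be the infinite tridiagonal matrix with superdiagonal [r], diagonal
    [s] and subdiagonal [t]. The recurrence says that row [n + 1] of [A] is row
    [n] of [A] times [J], and row [0] is the first unit vector.

    The proof has two halves. First, if [J] is q-TP then so is [A]
    ([recursive_matrix_q_TP]): a minor of [A] avoiding row [0] is, by the
    Cauchy-Binet formula, a sum of products of minors of [J] and minors of [A]
    with smaller rows; a minor using row [0] reduces to such a minor by
    expansion along that row.

    Second, [J] is q-TP under each of the three conditions ([tridiag_q_TP]).
    In each case [J] is the product of a lower bidiagonal matrix [L] and an
    upper bidiagonal matrix [U] plus a nonnegative diagonal matrix [D]:
    condition (i) takes [L] with entries [r (k + 1)] on the diagonal and [t k]
    below it, and all nonzero entries of [U] equal to 1; condition (ii) takes
    all nonzero entries of [L] equal to 1, and [U] with [t (k + 1)] on the diagonal and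
    [r k] above it; condition (iii) takes both diagonals equal to 1, with [t k]
    below and [r k] above. The sum [L U + D] is itself a single product [P Q]:
    interleave the columns of [L] with those of [D], and the rows of [U] with
    those of the identity. The nonzero entries of [P], and those of [Q], move
    weakly to the right from each row to the next. In any minor of such a
    staircase matrix only the identity permutation contributes
    ([det_staircase]), so [P] and [Q] are q-TP, and Cauchy-Binet concludes. *)

Import Order.TTheory GRing.Theory Num.Theory.
Local Open Scope ring_scope.

Set Implicit Arguments.
Unset Strict Implicit.
Unset Printing Implicit Defensive.

(** * The Cauchy-Binet formula *)

Lemma det_rowsub_perm (R : comNzRingType) (m N : nat) (Y : 'M[R]_(N, m))
    (f : 'I_m -> 'I_N) (s : 'S_m) :
  \det (rowsub (f \o s) Y) = (-1) ^+ s * \det (rowsub f Y).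
Proof.
have -> : rowsub (f \o s) Y = row_perm s (rowsub f Y).
  by apply/matrixP=> i j; rewrite !mxE.
by rewrite row_permE det_mulmx det_perm.
Qed.

Lemma det_colsub_perm (R : comNzRingType) (m N : nat) (X : 'M[R]_(m, N))
    (f : 'I_m -> 'I_N) (s : 'S_m) :
  \det (colsub (f \o s) X) = (-1) ^+ s * \det (colsub f X).
Proof. by rewrite -det_tr -[in RHS]det_tr !trmx_mxsub det_rowsub_perm. Qed.

(** The sum ranges over all functions [f] rather than over the increasing ones:
    noninjective functions contribute zero, and the [m`!] reorderings of an
    increasing function contribute the same term, whence the factor [m`!]. *)
Lemma Cauchy_Binet (R : comNzRingType) (m N : nat)
    (X : 'M[R]_(m, N)) (Y : 'M[R]_(N, m)) :
  \det (X *m Y) *+ m`! =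
  \sum_(f : {ffun 'I_m -> 'I_N}) \det (colsub f X) * \det (rowsub f Y).
Proof.
(* Expanding every row of the product gives a sum where only [Y] appears
   through determinants. *)
have expand : \det (X *m Y) =
    \sum_(f : {ffun 'I_m -> 'I_N}) (\prod_i X i (f i)) * \det (rowsub f Y).
  pose XY (s : 'S_m) i j := X i j * Y j (s i).
  transitivity (\sum_(f : {ffun 'I_m -> 'I_N}) \sum_(s : 'S_m)
                  (-1) ^+ s * \prod_i XY s i (f i)).
    rewrite exchange_big; apply: eq_bigr => /= s _; rewrite -big_distrr /=.
    congr (_ * _); rewrite -(bigA_distr_bigA (XY s)) /=.
    by apply: eq_bigr => i _; rewrite mxE.
  apply: eq_bigr => f _; rewrite big_distrr /=; apply: eq_bigr => s _.
  rewrite mulrCA big_split /=; congr (_ * (_ * _)).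
  by apply: eq_bigr => i _; rewrite mxE.
(* Reordering [f] by [s] moves a sign onto the product of entries of [X];
   summing over [s] then turns that product into a determinant. *)
have permuted (s : 'S_m) : \det (X *m Y) =
    \sum_(f : {ffun 'I_m -> 'I_N})
      ((-1) ^+ s * \prod_i X i (f (s i))) * \det (rowsub f Y).
  pose h (u : 'S_m) (f : {ffun 'I_m -> 'I_N}) := [ffun i => f (u i)].
  have hK : {in predT, cancel (h s) (h (s^-1)%g)}.
    by move=> f _; apply/ffunP=> i; rewrite !ffunE permKV.
  have hK' : {in predT, cancel (h (s^-1)%g) (h s)}.
    by move=> f _; apply/ffunP=> i; rewrite !ffunE permK.
  rewrite expand (reindex (h s)); last first.
    by exists (h (s^-1)%g).
  apply: eq_bigr => f _; have -> : rowsub (h s f) Y = rowsub (f \o s) Y.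
    by apply/matrixP=> i j; rewrite !mxE ffunE.
  rewrite det_rowsub_perm mulrA; congr (_ * _); rewrite mulrC; congr (_ * _).
  by apply: eq_bigr => i _; rewrite ffunE.
rewrite -card_Sn -sumr_const (eq_bigl predT) // (eq_bigr _ (fun s _ => permuted s)).
rewrite exchange_big; apply: eq_bigr => f _ /=; rewrite -big_distrl /=.
by congr (_ * _); apply: eq_bigr => s _; congr (_ * _);
  apply: eq_bigr => i _; rewrite mxE.
Qed.

(** * Increasing rearrangements and permutations *)

Lemma ord_perm_sort (m N : nat) (f : 'I_m -> 'I_N) :
  injective f -> exists s : 'S_m, {homo f \o s : i j / (i < j)%N}.
Proof.
move=> f_inj; pose le := relpre (@nat_of_ord N) leq.
pose tf := [tuple f i | i < m].
have le_tot : total le by move=> x y; apply: leq_total.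
have le_tr : transitive le by move=> y x z; apply: leq_trans.
have /tuple_permP[s Es] : perm_eq (sort le tf) tf by rewrite perm_sort.
exists s => i j ltij /=.
have x0 : 'I_N := f i.
have nthE (k : 'I_m) : nth x0 (sort le tf) k = f (s k).
  by rewrite Es -tnth_nth !tnth_mktuple.
have srt : sorted le (sort le tf) := sort_sorted le_tot tf.
have sz : size (sort le tf) = m by rewrite size_sort size_tuple.
have : le (nth x0 (sort le tf) i) (nth x0 (sort le tf) j).
  by apply: (sorted_ltn_nth le_tr) => //; rewrite inE sz.
rewrite !nthE /le /= leq_eqVlt => /orP[/eqP/val_inj/f_inj/perm_inj eqij|//].
by rewrite eqij ltnn in ltij.
Qed.

Lemma perm_homo_id (m : nat) (s : 'S_m) :
  {homo s : i j / (i < j)%N} -> s = 1%g.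
Proof.
have ge_id (u : 'S_m) : {homo u : i j / (i < j)%N} -> forall i : 'I_m, (i <= u i)%N.
  move=> u_homo [k ltkm]; elim: k ltkm => [//|k IHk] ltkm.
  have ltk : (k < m)%N by apply: ltnW.
  apply: leq_ltn_trans (IHk ltk) _; exact: u_homo.
move=> s_homo; have sV_homo : {homo (s^-1)%g : i j / (i < j)%N}.
  move=> i j ltij; case: ltnP => //; rewrite leq_eqVlt => /orP[/eqP/val_inj|].
    by move/perm_inj=> eqij; rewrite eqij ltnn in ltij.
  by move/s_homo; rewrite !permKV ltnNge (ltnW ltij).
apply/permP=> i; rewrite perm1; apply/val_inj/eqP; rewrite eqn_leq ge_id // andbT.
by have := ge_id _ sV_homo (s i); rewrite permK.
Qed.

(** * Polynomials with nonnegative coefficients *)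

Section CoefNonneg.

Context (R : realType).
Implicit Types p q : {poly R}.

Lemma coef_nonneg0 : coef_nonneg (0 : {poly R}).
Proof. by move=> i; rewrite coef0. Qed.

Lemma coef_nonneg1 : coef_nonneg (1 : {poly R}).
Proof. by move=> i; rewrite coef1 ler0n. Qed.

Lemma coef_nonnegD p q :
  coef_nonneg p -> coef_nonneg q -> coef_nonneg (p + q).
Proof. by move=> hp hq i; rewrite coefD addr_ge0. Qed.

Lemma coef_nonnegM p q :
  coef_nonneg p -> coef_nonneg q -> coef_nonneg (p * q).
Proof.
by move=> hp hq i; rewrite coefM sumr_ge0 // => j _; rewrite mulr_ge0.
Qed.

End CoefNonneg.

(** Consequence of Cauchy-Binet: a summand for an injective [f] is unchanged when
    [f] is sorted, since the two signs cancel. *)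
Lemma minor_mulmx_nonneg (R : realType) (m N : nat)
    (X : 'M[{poly R}]_(m, N)) (Y : 'M[{poly R}]_(N, m)) :
  (forall f : 'I_m -> 'I_N, {homo f : i j / (i < j)%N} ->
     coef_nonneg (\det (colsub f X))) ->
  (forall f : 'I_m -> 'I_N, {homo f : i j / (i < j)%N} ->
     coef_nonneg (\det (rowsub f Y))) ->
  coef_nonneg (\det (X *m Y)).
Proof.
move=> X_nonneg Y_nonneg.
suff : coef_nonneg (\det (X *m Y) *+ m`!).
  by move=> h i; have := h i; rewrite coefMn pmulrn_lge0 ?fact_gt0.
rewrite Cauchy_Binet; apply: big_ind => [||f _];
  [exact: coef_nonneg0|exact: coef_nonnegD|].
have [/injectiveP f_inj|/injectivePn[i1 [i2 Di Ef]]] := boolP (injectiveb f).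
  have [s fs_homo] := ord_perm_sort f_inj.
  have -> : \det (colsub f X) * \det (rowsub f Y) =
      \det (colsub (f \o s) X) * \det (rowsub (f \o s) Y).
    by rewrite det_colsub_perm det_rowsub_perm mulrACA -expr2 sqrr_sign mul1r.
  by apply: coef_nonnegM; [apply: X_nonneg|apply: Y_nonneg].
rewrite [X in _ * X](determinant_alternate Di) ?mulr0.
  exact: coef_nonneg0.
by move=> j; rewrite !mxE Ef.
Qed.

(** * Staircase matrices *)

(** If a permutation [s] has a nonzero term, all [M i (s i)] are nonzero, so [s]
    is increasing, hence the identity. *)
Lemma det_staircase (R : comNzRingType) (m : nat) (M : 'M[R]_m) :
  (forall i i' j j' : 'I_m, (i < i')%N -> M i j != 0 -> M i' j' != 0 ->
     (j <= j')%N) ->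
  \det M = \prod_i M i i.
Proof.
move=> stairs; rewrite /determinant (bigD1 1%g) //= odd_perm1 mul1r.
have -> : \prod_i M i ((1%g : 'S_m) i) = \prod_i M i i.
  by apply: eq_bigr => i _; rewrite perm1.
rewrite [X in _ + X]big1 ?addr0 // => s s_neq1.
have [i Mi0|M_neq0] := pickP (fun i => M i (s i) == 0).
  by rewrite (bigD1 i) //= (eqP Mi0) mul0r mulr0.
case/eqP: s_neq1; apply: perm_homo_id => i j ltij.
rewrite ltn_neqAle (stairs _ _ _ _ ltij) ?M_neq0 // andbT.
by apply: contraTneq ltij => /val_inj/perm_inj ->; rewrite ltnn.
Qed.

Lemma staircase_q_TP (R : realType) (M : nat -> nat -> {poly R}) :
  (forall i j, coef_nonneg (M i j)) ->
  (forall i i' j j', (i < i')%N -> M i j != 0 -> M i' j' != 0 -> (j <= j')%N) ->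
  q_TP M.
Proof.
move=> M_nonneg stairs m rows cols rows_homo cols_homo.
rewrite det_staircase => [|i i' j j' ltii'].
  apply: big_ind => [||i _]; [exact: coef_nonneg1|exact: coef_nonnegM|].
  by rewrite mxE.
rewrite !mxE => Mij Mij'.
have := stairs _ _ _ _ (rows_homo _ _ ltii') Mij Mij'.
by case: (ltnP j' j) => [/cols_homo|//]; rewrite ltnNge => /negPf->.
Qed.

(** * Tridiagonal matrices *)

(** The minors of a product of infinite matrices. The rows [row1] of [Z] are
    combinations of the first [N] rows of [Y], with coefficients taken from the
    rows [row2] of [X]; the two row selections differ when [Z] is a shift of the
    product. Only minors of [X] in the rows [row2] are needed. *)
Lemma minor_mul_nonneg (R : realType) (X Y Z : nat -> nat -> {poly R})
    (N m : nat) (row1 row2 cols : 'I_m -> nat) :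
  (forall i j, Z (row1 i) j = \sum_(k < N) X (row2 i) k * Y k j) ->
  (forall f : 'I_m -> nat, {homo f : i j / (i < j)%N} ->
     coef_nonneg (\det (\matrix_(i < m, j < m) X (row2 i) (f j)))) ->
  q_TP Y -> {homo cols : i j / (i < j)%N} ->
  coef_nonneg (\det (\matrix_(i < m, j < m) Z (row1 i) (cols j))).
Proof.
move=> ZE X_nonneg Y_TP cols_homo.
have -> : \matrix_(i, j) Z (row1 i) (cols j) =
    (\matrix_(i < m, k < N) X (row2 i) k) *m
    (\matrix_(k < N, j < m) Y k (cols j)).
  by apply/matrixP=> i j; rewrite !mxE ZE; apply: eq_bigr => k _; rewrite !mxE.
apply: minor_mulmx_nonneg => f f_homo.
  have -> : colsub f (\matrix_(i < m, k < N) X (row2 i) k) =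
      \matrix_(i < m, j < m) X (row2 i) (f j).
    by apply/matrixP=> i j; rewrite !mxE.
  exact: X_nonneg (fun i => nat_of_ord (f i)) f_homo.
have -> : rowsub f (\matrix_(k < N, j < m) Y k (cols j)) =
    \matrix_(i < m, j < m) Y (f i) (cols j).
  by apply/matrixP=> i j; rewrite !mxE.
exact: Y_TP (fun i => nat_of_ord (f i)) cols f_homo cols_homo.
Qed.

(** The infinite tridiagonal matrix with entries [r (i + 1)] at [(i, i + 1)],
    [s i] at [(i, i)] and [t i] at [(i, i - 1)]. *)
Definition tridiag (R : realType) (r s t : nat -> {poly R}) (i j : nat)
    : {poly R} :=
  if j == i.+1 then r j else if j == i then s i
  else if i == j.+1 then t i else 0.

Section Factors.

Context (R : realType) (l u m v d : nat -> {poly R}).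

(** Row [i] has the entries [m (i - 1)], [d i], [l i] in the consecutive columns
    [2i - 1], [2i], [2i + 1] (row [0] starts with [d 0]): the columns of the
    lower bidiagonal matrix with diagonal [l] and subdiagonal [m], at odd
    positions, interleaved with those of the diagonal matrix [d]. *)
Definition left_factor (i k : nat) : {poly R} :=
  if k == i.*2.+1 then l i else if k == i.*2 then d i
  else if k.+1 == i.*2 then m i.-1 else 0.

(** Row [2k] is the unit vector with index [k]; row [2k + 1] has [u k] in column
    [k] and [v k] in column [k + 1]: the rows of the identity interleaved with
    those of the upper bidiagonal matrix with diagonal [u] and superdiagonal
    [v]. *)
Definition right_factor (k j : nat) : {poly R} :=
  if j == k./2 then (if odd k then u j else 1)
  else if odd k && (j == (k./2).+1) then v k./2 else 0.

Lemma left_factor_support (i k : nat) :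
  left_factor i k != 0 -> (i.*2 <= k.+1 <= i.*2.+2)%N.
Proof.
rewrite /left_factor; case: (k =P i.*2.+1) => [-> _|_]; first by lia.
case: (k =P i.*2) => [-> _|_]; first by lia.
by case: (k.+1 =P i.*2) => [-> _|_]; rewrite ?eqxx //; lia.
Qed.

Lemma right_factor_support (k j : nat) :
  right_factor k j != 0 -> (k./2 <= j <= uphalf k)%N.
Proof.
rewrite /right_factor uphalf_half; case: (j =P k./2) => [-> _|_].
  by rewrite leqnn leq_addl.
by case: ifP => [/andP[-> /eqP-> _]|_]; rewrite ?eqxx // leqnSn leqnn.
Qed.

Lemma left_factor_q_TP :
  (forall k, coef_nonneg (l k)) -> (forall k, coef_nonneg (m k)) ->
  (forall k, coef_nonneg (d k)) -> q_TP left_factor.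
Proof.
move=> hl hm hd; apply: staircase_q_TP => [i j|i i' j j' ltii'].
  by rewrite /left_factor; do 3?[case: ifP => // _]; apply: coef_nonneg0.
move=> /left_factor_support/andP[_ j_le] /left_factor_support/andP[le_j' _].
by rewrite -ltnS (leq_trans j_le) // (leq_trans _ le_j') // -doubleS leq_double.
Qed.

Lemma right_factor_q_TP :
  (forall k, coef_nonneg (u k)) -> (forall k, coef_nonneg (v k)) ->
  q_TP right_factor.
Proof.
move=> hu hv; apply: staircase_q_TP => [k j|k k' j j' ltkk'].
  rewrite /right_factor; do 3?[case: ifP => // _];
    by [apply: coef_nonneg0 | apply: coef_nonneg1].
move=> /right_factor_support/andP[_ j_le] /right_factor_support/andP[le_j' _].
by apply: leq_trans j_le (leq_trans (half_leq ltkk') le_j').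
Qed.

(** The product of the two factors is the product of the bidiagonal matrices
    plus the diagonal matrix [d]; row [i] only involves columns up to [2i + 1] of
    the left factor. *)
Lemma factors_mul (N i j : nat) : (i.*2.+1 < N)%N ->
  \sum_(k < N) left_factor i k * right_factor k j =
  tridiag (fun k => l k.-1 * v k.-1)
    (fun k => d k + l k * u k + (if k is k'.+1 then m k' * v k' else 0))
    (fun k => m k.-1 * u k.-1) i j.
Proof.
move=> ltiN.
(* Isolate the columns [2i + 1] and [2i]; for [i > 0], also [2i - 1]. *)
rewrite (bigD1 (Ordinal ltiN)) //= (bigD1 (Ordinal (ltnW ltiN))) /=; last first.
  by rewrite -val_eqE /=; lia.
have -> : left_factor i i.*2.+1 = l i by rewrite /left_factor eqxx.
have -> : left_factor i i.*2 = d i.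
  by rewrite /left_factor eqxx ifN //; lia.
have rest0 (k : nat) : k != i.*2.+1 -> k != i.*2 -> k.+1 != i.*2 ->
    left_factor i k = 0.
  by rewrite /left_factor => /negPf-> /negPf-> /negPf->.
have E1 : right_factor i.*2.+1 j =
    if j == i then u j else if j == i.+1 then v i else 0.
  by rewrite /right_factor /= uphalf_double odd_double.
have E2 : right_factor i.*2 j = if j == i then 1 else 0.
  by rewrite /right_factor doubleK odd_double.
rewrite {}E1 {}E2; case: i => [|i] in ltiN rest0 *.
  rewrite big1 => [|k /andP[k1 k0]]; last first.
    by rewrite rest0 ?mul0r // -?val_eqE.
  rewrite /tridiag; case: j => [|[|j]] //=; ring.
have lti' : (i.*2.+1 < N)%N by rewrite doubleS in ltiN; lia.
rewrite (bigD1 (Ordinal lti')) /=; last first.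
  by rewrite -!val_eqE /= doubleS; lia.
rewrite big1 => [|k]; last first.
  rewrite -!val_eqE /= doubleS => /andP[/andP[k1 k2] k3].
  by rewrite rest0 ?mul0r // doubleS // eqSS.
have -> : left_factor i.+1 i.*2.+1 = m i.
  rewrite /left_factor doubleS ifN; last by lia.
  by rewrite ifN ?eqxx //; lia.
have -> : right_factor i.*2.+1 j =
    if j == i then u j else if j == i.+1 then v i else 0.
  by rewrite /right_factor /= uphalf_double odd_double.
rewrite /tridiag eqSS; do !case: eqP; try lia; move=> *; subst; rewrite /=; ring.
Qed.

End Factors.

(** A tridiagonal matrix that dominates, on the diagonal, the product of two
    nonnegative bidiagonal matrices with the same off-diagonal entries is
    q-TP. *)
Lemma tridiag_q_TP (R : realType) (r s t l u m v : nat -> {poly R}) :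
  (forall k, coef_nonneg (l k)) -> (forall k, coef_nonneg (u k)) ->
  (forall k, coef_nonneg (m k)) -> (forall k, coef_nonneg (v k)) ->
  (forall k, r k.+1 = l k * v k) -> (forall k, t k.+1 = m k * u k) ->
  (forall k, geq_q (s k)
     (l k * u k + (if k is k'.+1 then m k' * v k' else 0))) ->
  q_TP (tridiag r s t).
Proof.
move=> hl hu hm hv rE tE hs p rows cols rows_homo cols_homo.
pose d k := s k - (l k * u k + (if k is k'.+1 then m k' * v k' else 0)).
(* [N] exceeds [2i + 1] for every selected row [i]. *)
pose N := (\max_(i < p) rows i).*2.+2.
apply: (@minor_mul_nonneg _ (left_factor l m d) (right_factor u v) _ N _
          rows rows) => //.
- move=> i j; rewrite factors_mul; last by rewrite ltnS ltnS leq_double leq_bigmax.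
  rewrite /tridiag; case: eqP => [->|_]; first by rewrite rE.
  case: eqP => [_|_]; first by rewrite /d; case: (rows i) => [|k]; ring.
  by case: eqP => // ->; rewrite tE.
- by move=> f f_homo; apply: left_factor_q_TP.
- exact: right_factor_q_TP.
Qed.

(** * From the tridiagonal matrix to the recursive matrix *)

Lemma recursive_matrixS (R : realType) (r s t : nat -> {poly R})
    (A : nat -> nat -> {poly R}) (N n j : nat) :
  recursive_matrix r s t A -> (n < N)%N ->
  A n.+1 j = \sum_(k < N) A n k * tridiag r s t k j.
Proof.
case=> A_low _ -> ltnN.
(* A term with index [a >= N] is lost in the sum, but then [A n a = 0]. *)
have pick_term (a : nat) (c : {poly R}) :
    \sum_(k < N) (if k == a :> nat then A n k * c else 0) = A n a * c.
  rewrite -big_mkcond (big_ord1_eq _ (fun k => A n k * c)).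
  by case: ltnP => // leNa; rewrite A_low ?mul0r // (leq_trans ltnN).
case: j => [|j].
  rewrite add0r mulrC [t _ * _]mulrC -!pick_term -big_split /=.
  apply: eq_bigr => k _; rewrite /tridiag.
  by case: (nat_of_ord k) => [|[|{}k]] /=; rewrite ?mulr0 ?addr0 ?add0r.
rewrite mulrC [s _ * _]mulrC [t _ * _]mulrC -!pick_term -!big_split /=.
apply: eq_bigr => k _; rewrite /tridiag.
move: (nat_of_ord k) => {}k; rewrite eqSS [j == k]eq_sym [j.+1 == k]eq_sym.
case: (k =P j) => [->|_].
  by rewrite !ifN ?addr0 //; lia.
case: (k =P j.+1) => [->|_]; first by rewrite ifN ?addr0 ?add0r //; lia.
by case: (k =P j.+2) => [->|_]; rewrite ?mulr0 ?addr0 ?add0r.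
Qed.

Lemma recursive_matrix_q_TP (R : realType) (r s t : nat -> {poly R})
    (A : nat -> nat -> {poly R}) :
  recursive_matrix r s t A -> q_TP (tridiag r s t) -> q_TP A.
Proof.
move=> hA J_TP; have [A_low A00 _] := hA.
(* Induction on a strict bound [n] for the selected rows. *)
suff bounded n m (rows cols : 'I_m -> nat) : (forall i, (rows i < n)%N) ->
    {homo rows : i j / (i < j)%N} -> {homo cols : i j / (i < j)%N} ->
    coef_nonneg (\det (\matrix_(i < m, j < m) A (rows i) (cols j))).
  move=> m rows cols; apply: (bounded (\max_(i < m) rows i).+1) => i.
  by rewrite ltnS leq_bigmax.
elim: n => [|n IHn] in m rows cols *.
  case: m rows cols => [|m] rows cols rows_lt; last by have := rows_lt ord0.
  by move=> _ _; rewrite det_mx00; apply: coef_nonneg1.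
(* Minors avoiding row [0]: row [i > 0] of [A] is row [i - 1] of [A] times the
   tridiagonal matrix. *)
have positive p (rows' cols' : 'I_p -> nat) : (forall i, (0 < rows' i <= n)%N) ->
    {homo rows' : i j / (i < j)%N} -> {homo cols' : i j / (i < j)%N} ->
    coef_nonneg (\det (\matrix_(i < p, j < p) A (rows' i) (cols' j))).
  move=> rows_bd rows_homo cols_homo.
  apply: (@minor_mul_nonneg _ A (tridiag r s t) _ n _ rows'
            (fun i => (rows' i).-1)) => // [i j|f f_homo].
    have /andP[row_gt0 row_le] := rows_bd i.
    rewrite -{1}(prednK row_gt0); apply: recursive_matrixS => //.
    by rewrite prednK.
  apply: IHn => // [i|i j ltij]; have /andP[row_gt0 row_le] := rows_bd i.
    by rewrite prednK.
  by rewrite -ltnS !prednK ?rows_homo //; have /andP[] := rows_bd j.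
case: m => [|m] in rows cols * => rows_lt rows_homo cols_homo.
  by rewrite det_mx00; apply: coef_nonneg1.
have [row0|row_gt0] := posnP (rows ord0); last first.
  apply: positive => // i; rewrite -(ltnS _ n) rows_lt andbT.
  have [->//|i_neq0] := eqVneq i ord0.
  by apply: leq_ltn_trans (rows_homo ord0 i _); rewrite // lt0n.
(* Row [0] of [A] vanishes off column [0], so only the leading cofactor, a
   minor avoiding row [0], can contribute. *)
rewrite (expand_det_row _ ord0) big_ord_recl big1 ?addr0 => [|j _].
  apply: coef_nonnegM.
    rewrite mxE row0; case: (cols ord0) => [|c].
      by rewrite A00; apply: coef_nonneg1.
    by rewrite A_low //; apply: coef_nonneg0.
  rewrite /cofactor mul1r.
  have -> : row' ord0 (col' ord0 (\matrix_(i, j) A (rows i) (cols j))) =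
      \matrix_(i < m, j < m) A (rows (lift ord0 i)) (cols (lift ord0 j)).
    by apply/matrixP=> i j; rewrite !mxE.
  apply: positive => [i|i j ltij|i j ltij].
  - rewrite -(ltnS _ n) rows_lt andbT.
    by apply: leq_ltn_trans (rows_homo ord0 (lift ord0 i) _).
  - by apply: rows_homo.
  - by apply: cols_homo.
rewrite mxE row0 A_low ?mul0r //.
by apply: leq_ltn_trans (cols_homo ord0 (lift ord0 j) _).
Qed.

Unset Implicit Arguments.

Theorem theorem3p1 (R : realType) (r s t : nat -> {poly R})
    (A : nat -> nat -> {poly R})
    (hr : forall k : nat, (1 <= k)%N -> coef_nonneg (r k))
    (hs : forall k : nat, coef_nonneg (s k))
    (ht : forall k : nat, (1 <= k)%N -> coef_nonneg (t k))
    (hA : recursive_matrix r s t A)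
    (hcond :
      (geq_q (s 0%N) (r 1%N) /\
       forall k : nat, (1 <= k)%N -> geq_q (s k) (r k.+1 + t k))
      \/
      (geq_q (s 0%N) (t 1%N) /\
       forall k : nat, (1 <= k)%N -> geq_q (s k) (r k + t k.+1))
      \/
      (geq_q (s 0%N) 1 /\
       forall k : nat, (1 <= k)%N -> geq_q (s k) (r k * t k + 1))) :
  q_TP A.
Proof.
apply: (recursive_matrix_q_TP hA).
have hr1 k : coef_nonneg (r k.+1) by apply: hr.
have ht1 k : coef_nonneg (t k.+1) by apply: ht.
have h1 (k : nat) : coef_nonneg (1 : {poly R}) by apply: coef_nonneg1.
case: hcond => [[h0 hS]|[[h0 hS]|[h0 hS]]].
- apply: (@tridiag_q_TP _ r s t (fun k => r k.+1) (fun=> 1)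
            (fun k => t k.+1) (fun=> 1)) => // k; rewrite ?mulr1 //.
  by case: k => [|k]; rewrite ?addr0 // mulr1; apply: hS.
- apply: (@tridiag_q_TP _ r s t (fun=> 1) (fun k => t k.+1)
            (fun=> 1) (fun k => r k.+1)) => // k; rewrite ?mul1r //.
  by case: k => [|k]; rewrite ?addr0 // mul1r addrC; apply: hS.
- apply: (@tridiag_q_TP _ r s t (fun=> 1) (fun=> 1)
            (fun k => t k.+1) (fun k => r k.+1)) => // k;
    rewrite ?mul1r ?mulr1 //.
  by case: k => [|k]; rewrite ?addr0 // addrC mulrC; apply: hS.
Qed.
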